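(* Let $k\ge 1$ and $\alpha\ge1$. If there is a polynomial-time $\alpha$-approximation algorithm for the hereditary $k$-set packing problem, then there is a polynomial-time $\max\{\alpha,\frac{k+1}{k}\}$-approximation algorithm for the hereditary set packing problem.
   Context: The hereditary set packing problem: given a hereditary finite set family $\mathcal{S}$ (for every $s\in\mathcal{S}$, all nonempty subsets of $s$ belong to $\mathcal{S}$), represented implicitly by explicitly listing only its inclusion-wise maximal sets, find a subfamily $A\subseteq\mathcal{S}$ of pairwise disjoint sets maximizing $w(A)=\sum_{s\in A}(|s|-1)$. The hereditary $k$-set packing problem is the restriction of the hereditary set packing problem to instances in which every set has cardinality at most $k$. An $\alpha$-approximation algorithm returns a feasible solution of value at least $\frac{1}{\alpha}$ times the optimum. *)

(* Defs.v *)
From mathcomp Require Import all_boot all_order all_algebra.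
From mathcomp Require Import finmap.
From mathcomp Require Import reals.

Set Implicit Arguments.
Unset Strict Implicit.
Unset Printing Implicit Defensive.

Import Order.TTheory GRing.Theory Num.Theory.

(* Algorithms are programs of the language WHILE (N. D. Jones, "Computability
   and Complexity from a Programming Perspective", 1997): imperative programs
   manipulating binary trees (LISP lists) held in variables.

   The running time charges every read of a variable by the size of the tree
   read, and not by a constant.  Consequently a run of length t never builds a
   tree of size greater than t (there is no exponential growth through
   sharing), and such a run is simulated by a multitape Turing machine in time
   polynomial in t and in the input size.  Conversely, a Turing machine step
   costs a time linear in the size of its configuration.  Hence "polynomial
   time" has its usual meaning. *)

Inductive tree := Leaf | Node of tree & tree.

Fixpoint tsize (d : tree) : nat :=
  if d is Node d1 d2 then (tsize d1 + tsize d2).+1 else 1.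

Definition left_of (d : tree) := if d is Node d1 _ then d1 else Leaf.
Definition right_of (d : tree) := if d is Node _ d2 then d2 else Leaf.
Definition is_node (d : tree) := if d is Node _ _ then true else false.

Inductive expr :=
  | EVar of nat
  | ELeaf
  | ENode of expr & expr
  | ELeft of expr
  | ERight of expr.

Inductive cmd :=
  | Skip
  | Assign of nat & expr
  | Seq of cmd & cmd
  | If of expr & cmd & cmd
  | While of expr & cmd.

Definition store := nat -> tree.

Definition upd (m : store) (x : nat) (d : tree) : store :=
  fun y => if y == x then d else m y.

Fixpoint eval (e : expr) (m : store) : tree :=
  match e with
  | EVar x => m x
  | ELeaf => Leaf
  | ENode e1 e2 => Node (eval e1 m) (eval e2 m)
  | ELeft e1 => left_of (eval e1 m)
  | ERight e1 => right_of (eval e1 m)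
  end.

Fixpoint ecost (e : expr) (m : store) : nat :=
  match e with
  | EVar x => tsize (m x)
  | ELeaf => 1
  | ENode e1 e2 => (ecost e1 m + ecost e2 m).+1
  | ELeft e1 => (ecost e1 m).+1
  | ERight e1 => (ecost e1 m).+1
  end.

(* exec c m t m' : started in store m, the program c halts after time t in
   store m'.  A test succeeds when its value is not Leaf. *)
Inductive exec : cmd -> store -> nat -> store -> Prop :=
  | exec_skip m :
      exec Skip m 1 m
  | exec_assign x e m :
      exec (Assign x e) m (ecost e m).+1 (upd m x (eval e m))
  | exec_seq c1 c2 m t1 m1 t2 m2 :
      exec c1 m t1 m1 -> exec c2 m1 t2 m2 ->
      exec (Seq c1 c2) m (t1 + t2).+1 m2
  | exec_if_true e c1 c2 m t m' :
      is_node (eval e m) -> exec c1 m t m' ->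
      exec (If e c1 c2) m (ecost e m + t).+1 m'
  | exec_if_false e c1 c2 m t m' :
      ~~ is_node (eval e m) -> exec c2 m t m' ->
      exec (If e c1 c2) m (ecost e m + t).+1 m'
  | exec_while_true e c m t1 m1 t2 m2 :
      is_node (eval e m) -> exec c m t1 m1 -> exec (While e c) m1 t2 m2 ->
      exec (While e c) m (ecost e m + t1 + t2).+1 m2
  | exec_while_false e c m :
      ~~ is_node (eval e m) ->
      exec (While e c) m (ecost e m).+1 m.

(* The input is in variable 0, all other variables being initially Leaf; the
   output is the final value of variable 0. *)
Definition runs (c : cmd) (input : tree) (t : nat) (output : tree) : Prop :=
  exists2 m : store, exec c (upd (fun=> Leaf) 0 input) t m & m 0 = output.

(* Elements of the ground set are named by arbitrary bit strings, so that the
   encoding below has, up to a constant factor, the length of an explicit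
   listing. *)

Definition name : choiceType := seq bool.
Definition family := {fset {fset name}}.

Definition enc_seq (T : Type) (enc : T -> tree) (s : seq T) : tree :=
  foldr (fun x d => Node (enc x) d) Leaf s.

Definition enc_bit (b : bool) : tree := if b then Node Leaf Leaf else Leaf.
Definition enc_name (x : name) : tree := enc_seq enc_bit x.
Definition enc_listing (L : seq (seq name)) : tree :=
  enc_seq (enc_seq enc_name) L.

(* L lists the members of F explicitly, in any order and without repetition,
   each member being itself listed in any order and without repetition. *)
Definition lists (L : seq (seq name)) (F : family) : Prop :=
  all uniq L /\ perm_eq [seq [fset x in l]%fset | l <- L] (enum_fset F).

Definition hereditary (S : family) : Prop :=
  fset0 \notin S /\
  forall s t : {fset name},
    s \in S -> (t `<=` s)%fset -> t != fset0 -> t \in S.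

Definition hereditary_k (k : nat) (S : family) : Prop :=
  hereditary S /\ forall s : {fset name}, s \in S -> #|` s|%fset <= k.

Definition maximal_sets (S : family) : family :=
  [fset s in S | ~~ has (fun t : {fset name} => s `<` t) S]%fset.

Definition feasible (S A : family) : bool := (A `<=` S)%fset && trivIfset A.

(* The members of a feasible A are nonempty: the subtraction is exact. *)
Definition weight (A : family) : nat := \sum_(s <- A) (#|` s|%fset - 1).

Definition optimum (S : family) : nat :=
  \max_(A <- fpowerset S | feasible S A) weight A.

(* c is a polynomial-time alpha-approximation algorithm for hereditary set
   packing restricted to the instances satisfying I.  The polynomial bound is
   written b * n ^ d + b, with n the size of the input. *)
Definition poly_approx_algorithm (R : realType) (I : family -> Prop)
    (alpha : R) (c : cmd) : Prop :=
  exists b d : nat, forall (S : family) (L : seq (seq name)),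
    I S -> lists L (maximal_sets S) ->
    exists (t : nat) (LA : seq (seq name)) (A : family),
      [/\ runs c (enc_listing L) t (enc_listing LA),
          t <= b * tsize (enc_listing L) ^ d + b,
          lists LA A,
          feasible S A &
          (alpha^-1 * (optimum S)%:R <= (weight A)%:R)%R].

(* Main.v *)
Require Import Defs.
From mathcomp Require Import all_boot all_order all_algebra.
From mathcomp Require Import finmap.
From mathcomp Require Import boolp reals.
From mathcomp Require Import zify.
(* MathComp also has a [tsize] (for tuples); this restores the one of Defs. *)
Import Defs.

Set Implicit Arguments.
Unset Strict Implicit.
Unset Printing Implicit Defensive.

Import Order.TTheory GRing.Theory Num.Theory.

(* Go once through the listed maximal sets; whenever more than k elements of
   the current set l are still uncovered, select all of them as one set.
   Afterwards every listed set has at most k uncovered elements, so the sets of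
   S avoiding the covered elements form an instance S' of hereditary k-set
   packing, on which the given algorithm is run.  A selected set g has weight
   |g| - 1 >= k / (k + 1) |g|, while deleting the covered elements from an
   optimal solution loses at most 1 per element, so that
   opt(S) <= sum |g| + opt(S').

   As for polynomial time, the functions on trees computed by polynomial-time
   programs are closed under composition, pairing, conditionals, and left folds
   whose step enlarges the accumulator by at most twice the size of the element
   read; all that is needed besides the given algorithm is a few nested folds. *)

(** * Polynomial-time tree functions *)

Lemma tsize_gt0 d : 0 < tsize d.
Proof. by case: d. Qed.

Lemma tsize_left d : tsize (left_of d) <= tsize d.
Proof. by case: d => //= a b; lia. Qed.

Lemma tsize_right d : tsize (right_of d) <= tsize d.
Proof. by case: d => //= a b; lia. Qed.

Lemma tsize_eval e m : tsize (eval e m) <= ecost e m.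
Proof.
elim: e => //= [e1 IH1 e2 IH2|e IH|e IH]; first by lia.
- by have := tsize_left (eval e m); lia.
- by have := tsize_right (eval e m); lia.
Qed.

(** Reading a variable costs the size of its value, so no assignment creates a tree larger than the
    time it takes. *)
Lemma tsize_exec c m t m' x : exec c m t m' -> tsize (m' x) <= tsize (m x) + t.
Proof.
elim => {c m t m'} /=; try by move=> *; lia.
move=> y e m; rewrite /upd; case: eqP => _; last by lia.
by have := tsize_eval e m; lia.
Qed.

Lemma tsize_runs c x t y : runs c x t y -> tsize y <= tsize x + t.
Proof. by case=> m /(tsize_exec 0) + <-; rewrite /upd. Qed.

(** * Running a program as a subroutine in a larger store *)

Fixpoint ebound (e : expr) : nat :=
  match e with
  | EVar x => x.+1
  | ELeaf => 0
  | ENode e1 e2 => maxn (ebound e1) (ebound e2)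
  | ELeft e1 => ebound e1
  | ERight e1 => ebound e1
  end.

Fixpoint cbound (c : cmd) : nat :=
  match c with
  | Skip => 0
  | Assign x e => maxn x.+1 (ebound e)
  | Seq c1 c2 => maxn (cbound c1) (cbound c2)
  | If e c1 c2 => maxn (ebound e) (maxn (cbound c1) (cbound c2))
  | While e c1 => maxn (ebound e) (cbound c1)
  end.

Definition agree_below N (m m' : store) := forall x, x < N -> m x = m' x.
Definition agree_above N (m m' : store) := forall x, N <= x -> m x = m' x.

Lemma eval_agree e N m m' : ebound e <= N -> agree_below N m m' ->
  eval e m = eval e m' /\ ecost e m = ecost e m'.
Proof.
move=> + mm'; elim: e => //= [x /mm' -> //|e1 IH1 e2 IH2|e IH|e IH].
- by rewrite geq_max => /andP[/IH1[-> ->] /IH2[-> ->]].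
- by move=> /IH[-> ->].
- by move=> /IH[-> ->].
Qed.

(** A program sees only the variables below its bound. Hence data kept from [N] on neither
    influences it nor is changed by it, which allows subroutine calls. *)
Lemma exec_frame c m t m' : exec c m t m' ->
  forall N m1, cbound c <= N -> agree_below N m m1 ->
  exists m1', [/\ exec c m1 t m1', agree_below N m' m1' & agree_above N m1 m1'].
Proof.
elim => {c m t m'} /=.
- by move=> m N m1 _ ag; exists m1; split => //; exact: exec_skip.
- move=> x e m N m1; rewrite geq_max => /andP[xN eN] ag.
  have [ev ec] := eval_agree eN ag.
  exists (upd m1 x (eval e m)); split.
  + by rewrite ec ev; exact: exec_assign.
  + by move=> y yN; rewrite /upd; case: eqP => // _; exact: ag.
  + by move=> y yN; rewrite /upd; case: eqP => // yx; lia.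
- move=> c1 c2 m t1 m1 t2 m2 _ IH1 _ IH2 N n; rewrite geq_max => /andP[b1 b2] ag.
  have [n1 [e1 lo1 hi1]] := IH1 _ _ b1 ag.
  have [n2 [e2 lo2 hi2]] := IH2 _ _ b2 lo1.
  exists n2; split => //; first exact: exec_seq e1 e2.
  by move=> y yN; rewrite hi1 // hi2.
- move=> e c1 c2 m t m' ev _ IH N n; rewrite !geq_max => /and3P[b1 b2 b3] ag.
  have [evE ecE] := eval_agree b1 ag; have [n1 [e1 lo1 hi1]] := IH _ _ b2 ag.
  exists n1; split => //; rewrite ecE.
  by apply: exec_if_true => //; rewrite -evE.
- move=> e c1 c2 m t m' ev _ IH N n; rewrite !geq_max => /and3P[b1 b2 b3] ag.
  have [evE ecE] := eval_agree b1 ag; have [n1 [e1 lo1 hi1]] := IH _ _ b3 ag.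
  exists n1; split => //; rewrite ecE.
  by apply: exec_if_false => //; rewrite -evE.
- move=> e c m t1 m1 t2 m2 ev _ IH1 _ IH2 N n b ag.
  have /andP[b1 b2] : (ebound e <= N) && (cbound c <= N) by rewrite -geq_max.
  have [evE ecE] := eval_agree b1 ag; have [n1 [e1 lo1 hi1]] := IH1 _ _ b2 ag.
  have [n2 [e2 lo2 hi2]] := IH2 _ _ b lo1.
  exists n2; split => //; last by move=> y yN; rewrite hi1 // hi2.
  by rewrite ecE; apply: exec_while_true e1 e2; rewrite -evE.
- move=> e c m ev N n; rewrite geq_max => /andP[b1 b2] ag.
  have [evE ecE] := eval_agree b1 ag; exists n; split => //.
  by rewrite ecE; apply: exec_while_false; rewrite -evE.
Qed.

(** A program expects [Leaf] in every variable but 0, so a call must first erase what earlier calls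
    left behind. *)
Fixpoint clear (N : nat) : cmd :=
  if N is n.+1 then Seq (clear n) (Assign n ELeaf) else Skip.

Lemma exec_clear N m : exists m',
  [/\ exec (clear N) m (N * 3).+1 m',
      agree_below N m' (fun=> Leaf) & agree_above N m m'].
Proof.
elim: N => [|N [m' [ex lo hi]]] /=; first by exists m; split => //; exact: exec_skip.
exists (upd m' N Leaf); split.
- have -> : (N.+1 * 3).+1 = ((N * 3).+1 + 2).+1 by lia.
  exact: exec_seq ex (exec_assign _ ELeaf _).
- move=> y yN; rewrite /upd; case: eqP => // /eqP yN'; apply: lo; lia.
- move=> y yN; rewrite /upd; case: eqP => [|_]; first by lia.
  by apply: hi; lia.
Qed.

(* On the variables from N on, calling c acts as the assignment of its output
   on input src to dst. *)
Definition call (c : cmd) (N dst src : nat) : cmd :=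
  Seq (Seq (clear N) (Assign 0 (EVar src))) (Seq c (Assign dst (EVar 0))).

Lemma exec_call c N dst src m t y :
  0 < N -> cbound c <= N -> N <= dst -> N <= src -> runs c (m src) t y ->
  exists t' m',
    [/\ exec (call c N dst src) m t' m', agree_above N (upd m dst y) m'
      & t' <= N * 3 + 10 + 2 * (t + tsize (m src))].
Proof.
move=> N0 cN Nd Ns [mc ex <-].
have [m1 [ex1 lo1 hi1]] := exec_clear N m.
have := exec_assign 0 (EVar src) m1; rewrite /= -(hi1 _ Ns) => ex2.
have ag : agree_below N (upd (fun=> Leaf) 0 (m src)) (upd m1 0 (m src)).
  by move=> x xN; rewrite /upd; case: eqP => // _; rewrite lo1.
have [m3 [ex3 lo3 hi3]] := exec_frame ex cN ag.
have := exec_assign dst (EVar 0) m3; rewrite /= -(lo3 _ N0) => ex4.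
eexists _, _; split.
- exact: exec_seq (exec_seq ex1 ex2) (exec_seq ex3 ex4).
- move=> x xN; rewrite /upd; case: eqP => // _.
  rewrite -hi3 // /upd; case: eqP => [|_]; [lia | exact: hi1].
(* Copying the output costs its size, at most [t] plus the size of the input; whence the factor
   2. *)
- by have := tsize_exec 0 ex; rewrite /upd /=; lia.
Qed.

(** * Polynomial bounds and closure properties of polynomial-time functions *)

Definition polyb (f : nat -> nat) := exists b d, forall n, f n <= b * n.+1 ^ d.

Lemma polyb_le f g : (forall n, f n <= g n) -> polyb g -> polyb f.
Proof. by move=> fg [b [d gb]]; exists b, d => n; exact: leq_trans (gb n). Qed.

Lemma polyb_const c : polyb (fun=> c).
Proof. by exists c, 0 => n; rewrite muln1. Qed.

Lemma polyb_id : polyb id.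
Proof. by exists 1, 1 => n; lia. Qed.

Lemma polyb_add f g : polyb f -> polyb g -> polyb (fun n => f n + g n).
Proof.
move=> [b [d fb]] [b' [d' gb]]; exists (b + b'), (d + d') => n.
rewrite mulnDl leq_add //.
  by apply: leq_trans (fb n) _; rewrite leq_mul2l leq_pexp2l ?orbT ?leq_addr.
by apply: leq_trans (gb n) _; rewrite leq_mul2l leq_pexp2l ?orbT ?leq_addl.
Qed.

Lemma polyb_mul f g : polyb f -> polyb g -> polyb (fun n => f n * g n).
Proof.
move=> [b [d fb]] [b' [d' gb]]; exists (b * b'), (d + d') => n.
by rewrite expnD mulnACA leq_mul.
Qed.

Lemma polyb_monomial b d f : polyb f -> polyb (fun n => b * (f n).+1 ^ d).
Proof.
move=> fb; apply: polyb_mul; first exact: polyb_const.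
elim: d => [|d IH]; first exact: polyb_const.
apply: (@polyb_le _ (fun n => (f n + 1) * (f n).+1 ^ d)).
  by move=> n; rewrite expnS addn1.
by apply: polyb_mul => //; apply: polyb_add => //; exact: polyb_const.
Qed.

Ltac polyb := repeat first [ assumption | exact: polyb_const | exact: polyb_id
  | apply: polyb_add | apply: polyb_monomial | apply: polyb_mul ].

(** Nothing is claimed off [D]: the given algorithm is only guaranteed to work on encodings of
    instances. *)
Definition ptime_on (D : tree -> Prop) (f : tree -> tree) :=
  exists c B, polyb B /\
    forall x, D x -> exists2 t, runs c x t (f x) & t <= B (tsize x).

Lemma ptime_sub D E f : (forall x, D x -> E x) -> ptime_on E f -> ptime_on D f.
Proof. by move=> DE [c [B [Bp H]]]; exists c, B; split=> // x /DE/H. Qed.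

Lemma ptime_expr D e : ebound e <= 1 ->
  ptime_on D (fun x => eval e (upd (fun=> Leaf) 0 x)).
Proof.
move=> e1; exists (Assign 0 e).
have [C HC] : exists C, forall x, ecost e (upd (fun=> Leaf) 0 x) <= C + C * tsize x.
  elim: e e1 => /= [n n0||e1 IH1 e2 IH2|e IH /IH|e IH /IH].
  - by exists 1 => x; rewrite /upd; case: eqP => _ /=; lia.
  - by exists 1.
  - rewrite geq_max => /andP[/IH1[C1 H1] /IH2[C2 H2]]; exists (C1 + C2).+1 => x.
    by have := H1 x; have := H2 x; lia.
  - by move=> [C H]; exists C.+1 => x; have := H x; lia.
  - by move=> [C H]; exists C.+1 => x; have := H x; lia.
exists (fun n => C.+1 + C * n); split.
  apply: polyb_add (polyb_const _) (polyb_mul (polyb_const _) polyb_id).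
move=> x _; exists (ecost e (upd (fun=> Leaf) 0 x)).+1; last by have := HC x; lia.
by eexists; first exact: exec_assign.
Qed.

Lemma ptime_id D : ptime_on D id.
Proof. exact: (@ptime_expr D (EVar 0)). Qed.

Lemma ptime_leaf D : ptime_on D (fun=> Leaf).
Proof. exact: (@ptime_expr D ELeaf). Qed.

Lemma ptime_comp D E f g : ptime_on E g -> ptime_on D f ->
  (forall x, D x -> E (f x)) -> ptime_on D (fun x => g (f x)).
Proof.
move=> [cg [Bg [[b [d bd]] Hg]]] [cf [Bf [Bfp Hf]]] DE.
(* Both programs work strictly below [N], so variable [N] can carry the value from one call to the
   next. *)
pose N := (maxn (cbound cf) (cbound cg)).+1.
exists (Seq (Assign N (EVar 0)) (Seq (call cf N N N)
   (Seq (call cg N N N) (Assign 0 (EVar N))))).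
(* [Bg] need not be monotone; its monomial bound is, and is evaluated at [n + Bf n], which bounds
   the size of [f x]. *)
exists (fun n => (N * 6 + 100) + (20 * (Bf n + n) + 20 * (b * (n + Bf n).+1 ^ d))); split.
  by polyb.
move=> x Dx; have [tf rf tfB] := Hf x Dx; have [tg rg tgB] := Hg _ (DE _ Dx).
set m0 := upd (fun=> Leaf) 0 x.
have ex0 := exec_assign N (EVar 0) m0; set m1 := upd _ N _ in ex0.
have m1N : m1 N = x by rewrite /m1 /upd eqxx.
have rf' : runs cf (m1 N) tf (f x) by rewrite m1N.
have [||||t1 [m2 [ex1 ag1 b1]]] := @exec_call cf N N N m1 tf (f x) _ _ _ _ rf' => //.
  by rewrite /N; lia.
have m2N : m2 N = f x by rewrite -ag1 // /upd eqxx.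
have rg' : runs cg (m2 N) tg (g (f x)) by rewrite m2N.
have [||||t2 [m3 [ex2 ag2 b2]]] := @exec_call cg N N N m2 tg _ _ _ _ _ rg' => //.
  by rewrite /N; lia.
have m3N : m3 N = g (f x) by rewrite -ag2 // /upd eqxx.
have ex3 := exec_assign 0 (EVar N) m3.
eexists; first (eexists; first exact: exec_seq ex0 (exec_seq ex1 (exec_seq ex2 ex3))).
  by rewrite /upd.
have sf : tsize (f x) <= tsize x + tf by exact: tsize_runs rf.
have sg : tsize (g (f x)) <= tsize (f x) + tg by exact: tsize_runs rg.
have sf' : tsize (f x) <= tsize x + Bf (tsize x) by lia.
have tg' : tg <= b * (tsize x + Bf (tsize x)).+1 ^ d.
  apply: leq_trans tgB (leq_trans (bd _) _); rewrite leq_mul2l.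
  by case: (d) => [|d']; rewrite ?orbT // leq_exp2r // ltnS sf' orbT.
move: b1 b2; rewrite m1N m2N /= m3N /= {1}/m0 /upd /=; lia.
Qed.

Lemma ptime_pair D f g : ptime_on D f -> ptime_on D g ->
  ptime_on D (fun x => Node (f x) (g x)).
Proof.
move=> [cf [Bf [Bfp Hf]]] [cg [Bg [Bgp Hg]]].
pose N := (maxn (cbound cf) (cbound cg)).+1.
exists (Seq (Assign N (EVar 0)) (Seq (call cf N N.+1 N) (Seq (call cg N N.+2 N)
   (Assign 0 (ENode (EVar N.+1) (EVar N.+2)))))).
exists (fun n => (N * 6 + 100) + 20 * (Bf n + Bg n + n)); split; first by polyb.
move=> x Dx; have [tf rf tfB] := Hf x Dx; have [tg rg tgB] := Hg x Dx.
set m0 := upd (fun=> Leaf) 0 x.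
have ex0 := exec_assign N (EVar 0) m0; set m1 := upd _ N _ in ex0.
have m1N : m1 N = x by rewrite /m1 /upd eqxx.
have rf' : runs cf (m1 N) tf (f x) by rewrite m1N.
have [||||t1 [m2 [ex1 ag1 b1]]] := @exec_call cf N N.+1 N m1 tf (f x) _ _ _ _ rf' => //.
  by rewrite /N; lia.
have m2N : m2 N = x by rewrite -ag1 // /upd ltn_eqF.
have rg' : runs cg (m2 N) tg (g x) by rewrite m2N.
have [||||t2 [m3 [ex2 ag2 b2]]] := @exec_call cg N N.+2 N m2 tg _ _ _ _ _ rg' => //.
  by rewrite /N; lia.
  by lia.
have m3f : m3 N.+1 = f x.
  by rewrite -ag2 // {1}/upd ltn_eqF // -ag1 // /upd eqxx.
have m3g : m3 N.+2 = g x by rewrite -ag2; [rewrite /upd eqxx | lia].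
have ex3 := exec_assign 0 (ENode (EVar N.+1) (EVar N.+2)) m3.
eexists; first (eexists; first exact: exec_seq ex0 (exec_seq ex1 (exec_seq ex2 ex3))).
  by rewrite /upd /= m3f m3g.
have sf : tsize (f x) <= tsize x + tf by exact: tsize_runs rf.
have sg : tsize (g x) <= tsize x + tg by exact: tsize_runs rg.
move: b1 b2; rewrite m1N m2N /= m3f m3g {1}/m0 /upd /=; lia.
Qed.

Lemma ptime_if D p f g : ptime_on D p -> ptime_on D f -> ptime_on D g ->
  ptime_on D (fun x => if is_node (p x) then f x else g x).
Proof.
move=> [cp [Bp [Bpp Hp]]] [cf [Bf [Bfp Hf]]] [cg [Bg [Bgp Hg]]].
pose N := (maxn (cbound cp) (maxn (cbound cf) (cbound cg))).+1.
exists (Seq (Assign N (EVar 0)) (Seq (call cp N N.+1 N)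
   (Seq (If (EVar N.+1) (call cf N N.+1 N) (call cg N N.+1 N))
   (Assign 0 (EVar N.+1))))).
exists (fun n => (N * 6 + 100) + 20 * (Bf n + Bg n + Bp n + n)); split.
  by polyb.
move=> x Dx; have [tp rp tpB] := Hp x Dx.
have [tf rf tfB] := Hf x Dx; have [tg rg tgB] := Hg x Dx.
set m0 := upd (fun=> Leaf) 0 x.
have ex0 := exec_assign N (EVar 0) m0; set m1 := upd _ N _ in ex0.
have m1N : m1 N = x by rewrite /m1 /upd eqxx.
have rp' : runs cp (m1 N) tp (p x) by rewrite m1N.
have [||||t1 [m2 [ex1 ag1 b1]]] := @exec_call cp N N.+1 N m1 tp (p x) _ _ _ _ rp' => //.
  by rewrite /N; lia.
have m2N : m2 N = x by rewrite -ag1 // /upd ltn_eqF.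
have m2p : m2 N.+1 = p x by rewrite -ag1 // /upd eqxx.
have sp : tsize (p x) <= tsize x + tp by exact: tsize_runs rp.
set y := if _ then _ else _.
suff [t2 [m3 [ex2 m3y b2]]] : exists t2 m3,
    [/\ exec (If (EVar N.+1) (call cf N N.+1 N) (call cg N N.+1 N)) m2 t2 m3,
       m3 N.+1 = y & t2 + tsize y <= N * 3 + 12 + 4 * (tf + tg + tp + tsize x)].
  have ex3 := exec_assign 0 (EVar N.+1) m3.
  eexists; first (eexists; first exact: exec_seq ex0 (exec_seq ex1 (exec_seq ex2 ex3))).
    by rewrite /upd /= m3y.
  move: b1; rewrite m1N /= m3y {1}/m0 /upd /=; lia.
rewrite /y; case: ifP => px.
- have rf' : runs cf (m2 N) tf (f x) by rewrite m2N.
  have [||||t2 [m3 [ex2 ag2 b2]]] := @exec_call cf N N.+1 N m2 tf _ _ _ _ _ rf' => //.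
    by rewrite /N; lia.
  have sf : tsize (f x) <= tsize x + tf by exact: tsize_runs rf.
  eexists _, m3; split; first by apply: exec_if_true ex2; rewrite /= m2p.
    by rewrite -ag2 // /upd eqxx.
  by move: b2; rewrite m2N /= m2p; lia.
- have rg' : runs cg (m2 N) tg (g x) by rewrite m2N.
  have [||||t2 [m3 [ex2 ag2 b2]]] := @exec_call cg N N.+1 N m2 tg _ _ _ _ _ rg' => //.
    by rewrite /N; lia.
  have sg : tsize (g x) <= tsize x + tg by exact: tsize_runs rg.
  eexists _, m3; split; first by apply: exec_if_false ex2; rewrite /= m2p px.
    by rewrite -ag2 // /upd eqxx.
  by move: b2; rewrite m2N /= m2p; lia.
Qed.

(** * Folds over lists in polynomial time *)

Fixpoint tolist (d : tree) : seq tree :=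
  if d is Node d1 d2 then d1 :: tolist d2 else [::].

Lemma tolist_enc (T : Type) (enc : T -> tree) s : tolist (enc_seq enc s) = map enc s.
Proof. by elim: s => //= x s ->. Qed.

Lemma tsize_foldl (h : tree -> tree -> tree -> tree) c a l :
  (forall c a e, tsize (h c a e) <= tsize a + 2 * tsize e) ->
  tsize (foldl (h c) a (tolist l)) <= tsize a + 2 * tsize l.
Proof.
move=> H; elim: l a => [|e _ l IH] a /=; first by lia.
by have := IH (h c a e); have := H c a e; lia.
Qed.

Lemma size_tolist l : size (tolist l) <= tsize l.
Proof. by elim: l => //= e _ l IH; lia. Qed.

(** The growth condition keeps the accumulator linear in the size of the input throughout the loop,
    so each of the linearly many iterations calls the step on an argument of linear size. Without
    it, iterating a polynomial-time step could produce exponentially large values. *)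
Lemma ptime_fold_base (h : tree -> tree -> tree -> tree) :
  ptime_on (fun=> True) (fun z => h (left_of z) (left_of (right_of z)) (right_of (right_of z))) ->
  (forall c a e, tsize (h c a e) <= tsize a + 2 * tsize e) ->
  ptime_on (fun=> True) (fun z => foldl (h (left_of z)) (left_of (right_of z))
                                     (tolist (right_of (right_of z)))).
Proof.
move=> [ch [Bh [[b [d bd]] Hh]]] hs.
pose N := (cbound ch).+1.
(* Variable [N] holds the parameter, [N.+1] the accumulator, [N.+2] the unread part of the list, and
   [N.+3] the argument of the step. *)
pose body := Seq (Assign N.+3 (ENode (EVar N) (ENode (EVar N.+1) (ELeft (EVar N.+2)))))
  (Seq (call ch N N.+1 N.+3) (Assign N.+2 (ERight (EVar N.+2)))).
exists (Seq (Assign N (ELeft (EVar 0)))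
  (Seq (Assign N.+1 (ELeft (ERight (EVar 0))))
  (Seq (Assign N.+2 (ERight (ERight (EVar 0))))
  (Seq (While (EVar N.+2) body) (Assign 0 (EVar N.+1)))))).
(* [U n] bounds the cost of one iteration on inputs of size [n]; [n * 10] bounds the size of the
   argument of the step. *)
pose U n := N * 3 + 100 + (20 * (b * (n * 10).+1 ^ d) + 100 * n).
exists (fun n => 100 * n + 100 + (n + 1) * U n); split.
  by rewrite /U; polyb.
move=> x _.
(* [tsize a + 2 * tsize l] serves as a potential: it never increases, since the element consumed
   pays for the growth of the accumulator. *)
have loop n c l : forall a m, m N = c -> m N.+1 = a -> m N.+2 = l ->
    tsize c <= n -> tsize l <= n -> tsize a + 2 * tsize l <= 4 * n ->
  exists t m', [/\ exec (While (EVar N.+2) body) m t m',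
     m' N.+1 = foldl (h c) a (tolist l) & t <= (size (tolist l)).+1 * U n].
  elim: l => [|e _ l IH] a m mc ma ml cn ln an.
    exists 2, m; split; [|by []|by rewrite mul1n /U; move: (b * _) => v; lia].
    have := @exec_while_false (EVar N.+2) body m; rewrite /= ml /=; exact.
  set z := Node c (Node a e).
  have ex1 := exec_assign N.+3 (ENode (EVar N) (ENode (EVar N.+1) (ELeft (EVar N.+2)))) m.
  set m1 := upd _ _ _ in ex1.
  have m1z : m1 N.+3 = z by rewrite /m1 /upd eqxx /= mc ma ml.
  have [th rh thB] := Hh z I; rewrite /= in rh.
  rewrite -m1z in rh.
  have [||||t2 [m2 [ex2 ag2 b2]]] := @exec_call ch N N.+1 N.+3 m1 th _ _ _ _ _ rh => //.
    by rewrite /N; lia.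
  have ex3 := exec_assign N.+2 (ERight (EVar N.+2)) m2.
  set m3 := upd _ _ _ in ex3.
  have m2l : m2 N.+2 = Node e l.
    rewrite -ag2; last by lia.
    rewrite /upd /m1 /upd; do !case: eqP => //; lia.
  have [||||||t4 [m4 [ex4 m4E t4B]]] := IH (h c a e) m3 => //.
  - rewrite /m3 {1}/upd; case: eqP => [|_]; first by lia.
    rewrite -ag2; last by lia.
    rewrite /upd /m1 /upd; do !case: eqP => //; lia.
  - rewrite /m3 {1}/upd; case: eqP => [|_]; first by lia.
    rewrite -ag2; last by lia.
    by rewrite /upd eqxx.
  - by rewrite /m3 /upd eqxx /= m2l.
  - by move: ln => /=; lia.
  - by move: an => /=; have := hs c a e; lia.
  have ex := exec_while_true (e := EVar N.+2) _ (exec_seq ex1 (exec_seq ex2 ex3)) ex4.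
  eexists _, m4; split; first by apply: ex; rewrite /= ml.
    by rewrite m4E.
  have zn : tsize z <= n * 10 by move: an ln; rewrite /=; lia.
  have thU : th <= b * (n * 10).+1 ^ d.
    apply: leq_trans thB (leq_trans (bd _) _); rewrite leq_mul2l.
    by case: (d) => [|d']; rewrite ?orbT // leq_exp2r // ltnS zn orbT.
  rewrite [size _]/= [X in _ <= X]mulSn.
  move: b2; rewrite m1z /= ml m2l mc ma /=.
  move: t4B zn an ln; rewrite /z /=.
  have : U n = N * 3 + 100 + (20 * (b * (n * 10).+1 ^ d) + 100 * n) by [].
  lia.
set m0 := upd (fun=> Leaf) 0 x.
have ex0 := exec_assign N (ELeft (EVar 0)) m0; set m1 := upd _ N _ in ex0.
have ex1 := exec_assign N.+1 (ELeft (ERight (EVar 0))) m1; set m2 := upd _ _ _ in ex1.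
have ex2 := exec_assign N.+2 (ERight (ERight (EVar 0))) m2; set m3 := upd _ _ _ in ex2.
have m10 : m1 0 = x by [].
have m20 : m2 0 = x by [].
have sl := tsize_left x; have sr := tsize_right x.
have slr := tsize_left (right_of x); have srr := tsize_right (right_of x).
have [||||||t4 [m4 [ex4 m4E t4B]]] := loop (tsize x) (left_of x)
    (right_of (right_of x)) (left_of (right_of x)) m3; try lia.
- rewrite /m3 /m2 /m1 /upd; do !case: eqP => //; lia.
- rewrite /m3 {1}/upd; case: eqP => [|_]; first by lia.
  by rewrite /m2 /upd eqxx.
- by rewrite /m3 /upd eqxx.
have ex5 := exec_assign 0 (EVar N.+1) m4.
eexists.
  eexists; first exact: exec_seq ex0 (exec_seq ex1 (exec_seq ex2 (exec_seq ex4 ex5))).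
  by rewrite /upd /= m4E.
rewrite /= m10 m20 m4E.
have := @tsize_foldl h (left_of x) (left_of (right_of x)) (right_of (right_of x)) hs.
have sn := size_tolist (right_of (right_of x)).
have : t4 <= (tsize x + 1) * U (tsize x).
  by apply: leq_trans t4B _; rewrite leq_mul2r; apply/orP; right; lia.
have -> : m0 0 = x by [].
lia.
Qed.

Definition ptime2 (g : tree -> tree -> tree) :=
  ptime_on (fun=> True) (fun z => g (left_of z) (right_of z)).

Lemma ptime_app2 D g f1 f2 : ptime2 g -> ptime_on D f1 -> ptime_on D f2 ->
  ptime_on D (fun x => g (f1 x) (f2 x)).
Proof. by move=> pg p1 p2; apply: ptime_comp pg (ptime_pair p1 p2) _. Qed.

Lemma ptime_foldl D h f a l :
  ptime_on (fun=> True)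
    (fun z => h (left_of z) (left_of (right_of z)) (right_of (right_of z))) ->
  (forall c a e, tsize (h c a e) <= tsize a + 2 * tsize e) ->
  ptime_on D f -> ptime_on D a -> ptime_on D l ->
  ptime_on D (fun x => foldl (h (f x)) (a x) (tolist (l x))).
Proof.
move=> ph hs pf pa pl.
exact: (ptime_comp (ptime_fold_base ph hs) (ptime_pair pf (ptime_pair pa pl))).
Qed.

Lemma ptime_left D f : ptime_on D f -> ptime_on D (fun x => left_of (f x)).
Proof. by move=> pf; apply: ptime_comp (@ptime_expr (fun=> True) (ELeft (EVar 0)) isT) pf _. Qed.

Lemma ptime_right D f : ptime_on D f -> ptime_on D (fun x => right_of (f x)).
Proof. by move=> pf; apply: ptime_comp (@ptime_expr (fun=> True) (ERight (EVar 0)) isT) pf _. Qed.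

(** * The greedy selection and the residual listing as folds *)

Definition true_tree := Node Leaf Leaf.
Definition not_tree d := if is_node d then Leaf else true_tree.

(** The letter [e] of one name is compared with [left_of (left_of a)], the next letter of the other
    name. *)
Definition eq_step (_ a e : tree) : tree :=
  if is_node a then
    if is_node (left_of a) then
      if is_node e then
        if is_node (left_of (left_of a)) then Node (right_of (left_of a)) Leaf else Leaf
      else
        if is_node (left_of (left_of a)) then Leaf else Node (right_of (left_of a)) Leaf
    else Leaf
  else Leaf.

(* The accumulator is [Node r Leaf], r being what remains of y after the prefix
   of x read so far, and Leaf after a mismatch. *)
Definition eq_tree x y :=
  let r := foldl (eq_step Leaf) (Node y Leaf) (tolist x) in
  if is_node r then not_tree (left_of r) else Leaf.

Definition has_tree (p : tree -> tree -> tree) c l :=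
  foldl (fun a e => if is_node (p c e) then true_tree else a) Leaf (tolist l).

(** Survivors are pushed to the front and thus come out in reverse order; this is the origin of
    [rev] in the list versions. *)
Definition filter_tree (p : tree -> tree -> tree) c l :=
  foldl (fun a e => if is_node (p c e) then Node e a else a) Leaf (tolist l).

Definition mem_tree := has_tree eq_tree.
Definition uncovered_tree A x := not_tree (has_tree mem_tree x A).
Definition diff_tree A l := filter_tree uncovered_tree A l.
Definition notmem_tree y x := not_tree (mem_tree x y).
Definition sub_tree l y := not_tree (has_tree notmem_tree y l).
Definition notsub_tree l y := not_tree (sub_tree y l).

(** As [k] is a constant, a list has more than [k] elements exactly if a node remains after [k] uses
    of [right_of]. *)
Definition greedy_step k (_ a l : tree) :=
  if is_node (iter k right_of (diff_tree a l)) then Node (diff_tree a l) a else a.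
Definition greedy_tree k L := foldl (greedy_step k Leaf) Leaf (tolist L).

(** Distinct maximal sets may leave equal, comparable or empty remainders, whereas an instance must
    list only its maximal sets, once each. So a remainder is skipped if it is empty or inside a kept
    one, and otherwise evicts those inside it. *)
Definition residual_step A a l :=
  if is_node (diff_tree A l) then
    if is_node (has_tree sub_tree (diff_tree A l) a) then a
    else Node (diff_tree A l) (filter_tree notsub_tree (diff_tree A l) a)
  else a.
Definition residual_tree A L := foldl (residual_step A) Leaf (tolist L).

Definition cat_tree A B := foldl (fun a e => Node e a) B (tolist A).

(** * Polynomial time of the selection and residual folds *)

Lemma ptime_not D f : ptime_on D f -> ptime_on D (fun x => not_tree (f x)).
Proof.
move=> pf; apply: ptime_if => //; first exact: ptime_leaf.
by apply: ptime_pair; exact: ptime_leaf.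
Qed.

Lemma tsize_eq_step c a e : tsize (eq_step c a e) <= tsize a + 2 * tsize e.
Proof.
have := tsize_gt0 a; have := tsize_gt0 e.
by rewrite /eq_step; case: a => [|[|a1 a2] a3] /=; do ?case: ifP => _ /=; lia.
Qed.

Lemma ptime_eq : ptime2 eq_tree.
Proof.
have pid := ptime_id (fun=> True).
have pl := ptime_left pid; have pr := ptime_right pid.
have pleaf := ptime_leaf (fun=> True).
have pf : ptime_on (fun=> True)
    (fun z => foldl (eq_step Leaf) (Node (right_of z) Leaf) (tolist (left_of z))).
  apply: (ptime_foldl (h := eq_step) _ _ pleaf (ptime_pair pr pleaf) pl).
    have prl := ptime_left pr; have prr := ptime_right pr.
    have nxt := ptime_pair (ptime_right (ptime_left prl)) pleaf.
    by do !apply: ptime_if => //; do !apply: ptime_left => //.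
  exact: tsize_eq_step.
apply: (ptime_if pf); last exact: ptime_leaf.
by apply: ptime_not; apply: ptime_left.
Qed.

Lemma ptime_has p : ptime2 p -> ptime2 (has_tree p).
Proof.
move=> pp; have pid := ptime_id (fun=> True).
have pl := ptime_left pid; have pr := ptime_right pid.
have pleaf := ptime_leaf (fun=> True).
apply: (ptime_foldl (h := fun c a e => if is_node (p c e) then true_tree else a)
         _ _ pl pleaf pr).
  apply: ptime_if; last exact: ptime_left.
    by apply: ptime_app2 => //; exact: ptime_right.
  exact: ptime_pair.
move=> c a e; have := tsize_gt0 a; have := tsize_gt0 e.
by case: ifP => _ /=; lia.
Qed.

Lemma tsize_filter_tree p c l : tsize (filter_tree p c l) <= tsize l.
Proof.
(* The bound is strict because the initial [Leaf] has size 1, which is then cancelled. *)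
suff H a : tsize (foldl (fun a e => if is_node (p c e) then Node e a else a) a (tolist l))
    < tsize a + tsize l by have := H Leaf; rewrite /filter_tree /=; lia.
elim: l a => [|e _ l IH] a /=; first by lia.
by apply: leq_trans (IH _) _; case: ifP => _ /=; lia.
Qed.

Lemma ptime_filter p : ptime2 p -> ptime2 (filter_tree p).
Proof.
move=> pp; have pid := ptime_id (fun=> True).
have pl := ptime_left pid; have pr := ptime_right pid.
have pleaf := ptime_leaf (fun=> True).
apply: (ptime_foldl (h := fun c a e => if is_node (p c e) then Node e a else a)
         _ _ pl pleaf pr).
  have prl := ptime_left pr; have prr := ptime_right pr.
  by apply: ptime_if => //; [exact: ptime_app2 | exact: ptime_pair].
move=> c a e; have := tsize_gt0 a; have := tsize_gt0 e.
by case: ifP => _ /=; lia.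
Qed.

Lemma ptime2_not g : ptime2 g -> ptime2 (fun x y => not_tree (g x y)).
Proof. by move=> pg; apply: ptime_not. Qed.

Lemma ptime2_swap g : ptime2 g -> ptime2 (fun x y => g y x).
Proof.
move=> pg; have pid := ptime_id (fun=> True).
exact: ptime_app2 pg (ptime_right pid) (ptime_left pid).
Qed.

Lemma ptime_mem : ptime2 mem_tree.
Proof. exact: ptime_has ptime_eq. Qed.

Lemma ptime_diff : ptime2 diff_tree.
Proof. exact: ptime_filter (ptime2_not (ptime2_swap (ptime_has ptime_mem))). Qed.

Lemma ptime_sub_tree : ptime2 sub_tree.
Proof.
exact: ptime2_not (ptime2_swap (ptime_has (ptime2_not (ptime2_swap ptime_mem)))).
Qed.

Lemma ptime_greedy k : ptime_on (fun=> True) (greedy_tree k).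
Proof.
have pid := ptime_id (fun=> True).
have pl := ptime_left pid; have pr := ptime_right pid.
have pleaf := ptime_leaf (fun=> True).
apply: (ptime_foldl (h := greedy_step k) _ _ pleaf pleaf pid).
  have prl := ptime_left pr; have prr := ptime_right pr.
  have pd := ptime_app2 ptime_diff prl prr.
  apply: ptime_if; [|exact: ptime_pair|by []].
  by elim: k => //= k; exact: ptime_right.
move=> c a e; have := tsize_gt0 e; have := tsize_filter_tree uncovered_tree a e.
by rewrite /greedy_step /diff_tree; case: ifP => _ /=; lia.
Qed.

Lemma ptime_residual : ptime2 residual_tree.
Proof.
have pid := ptime_id (fun=> True).
have pl := ptime_left pid; have pr := ptime_right pid.
have pleaf := ptime_leaf (fun=> True).
apply: (ptime_foldl (h := residual_step) _ _ pl pleaf pr).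
  have prl := ptime_left pr; have prr := ptime_right pr.
  have pd := ptime_app2 ptime_diff pl prr.
  apply: ptime_if => //; apply: ptime_if => //.
    exact: ptime_app2 (ptime_has ptime_sub_tree) pd prl.
  apply: ptime_pair => //.
  exact: ptime_app2 (ptime_filter (ptime2_not (ptime2_swap ptime_sub_tree))) pd prl.
(* Filtering enlarges neither [e] nor the accumulator, so a step adds at most [tsize e] and one
   node. *)
move=> c a e; have := tsize_gt0 e; have := tsize_filter_tree uncovered_tree c e.
have := tsize_filter_tree notsub_tree (diff_tree c e) a.
by rewrite /residual_step /diff_tree; do !case: ifP => _ /=; lia.
Qed.

Lemma ptime_cat : ptime2 cat_tree.
Proof.
have pid := ptime_id (fun=> True).
have pl := ptime_left pid; have pr := ptime_right pid.
apply: (ptime_foldl (h := fun _ a e => Node e a) _ _ (ptime_leaf _) pr pl).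
  by apply: ptime_pair; [exact: ptime_right | exact: ptime_left].
by move=> c a e /=; have := tsize_gt0 e; lia.
Qed.

(** * List versions of the folds and their agreement with the tree versions *)

Definition covered (A : seq (seq name)) (x : name) := has (fun s => x \in s) A.
Definition diff A (l : seq name) := rev [seq x <- l | ~~ covered A x].

Definition greedy k (L : seq (seq name)) :=
  foldl (fun A l => if k < size (diff A l) then diff A l :: A else A) [::] L.

Definition residual A (L : seq (seq name)) :=
  foldl (fun M l =>
    if 0 < size (diff A l) then
      if has (fun y : seq name => all (mem y) (diff A l)) M then M
      else diff A l :: rev [seq y <- M | ~~ all (mem (diff A l)) y]
    else M) [::] L.

Lemma is_node_not d : is_node (not_tree d) = ~~ is_node d.
Proof. by case: d. Qed.

Lemma is_node_enc (T : Type) (enc : T -> tree) s :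
  is_node (enc_seq enc s) = (0 < size s).
Proof. by case: s. Qed.

Lemma is_node_drop (T : Type) (enc : T -> tree) s k :
  is_node (iter k right_of (enc_seq enc s)) = (k < size s).
Proof.
elim: k s => [|k IH] s; first exact: is_node_enc.
by rewrite iterSr; case: s => [|x s] /=; [elim: (k) => //= n; case: (iter _ _ _)
  | rewrite IH].
Qed.

Lemma has_treeP (T U : Type) (enc : T -> tree) (enc' : U -> tree) p (q : U -> T -> bool) c s :
  (forall u x, is_node (p (enc' u) (enc x)) = q u x) ->
  is_node (has_tree p (enc' c) (enc_seq enc s)) = has (q c) s.
Proof.
move=> pq; rewrite /has_tree tolist_enc.
suff H a : is_node (foldl (fun a e => if is_node (p (enc' c) e) then true_tree else a)
    a (map enc s)) = is_node a || has (q c) s by rewrite H.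
elim: s a => [|x s IH] a /=; first by rewrite orbF.
by rewrite IH pq; case: ifP; rewrite ?orbT.
Qed.

Lemma filter_treeP (T U : Type) (enc : T -> tree) (enc' : U -> tree) p (q : U -> T -> bool) c s :
  (forall u x, is_node (p (enc' u) (enc x)) = q u x) ->
  filter_tree p (enc' c) (enc_seq enc s) = enc_seq enc (rev (filter (q c) s)).
Proof.
move=> pq; rewrite /filter_tree tolist_enc.
suff H a : foldl (fun a e => if is_node (p (enc' c) e) then Node e a else a)
    (enc_seq enc a) (map enc s) = enc_seq enc (catrev (filter (q c) s) a) by rewrite (H [::]).
elim: s a => [|x s IH] a //=.
by rewrite pq; case: ifP => _; rewrite -IH.
Qed.

Lemma eq_treeP (x y : name) : is_node (eq_tree (enc_name x) (enc_name y)) = (x == y).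
Proof.
rewrite /eq_tree /enc_name tolist_enc.
have stuck s : foldl (eq_step Leaf) Leaf s = Leaf by elim: s.
elim: x y => [|b x IH] [|b' y] //=; first by rewrite stuck.
rewrite eqseq_cons -IH.
by case: b; case: b' => //=; rewrite stuck.
Qed.

Lemma mem_treeP (x : name) l : is_node (mem_tree (enc_name x) (enc_seq enc_name l)) = (x \in l).
Proof.
rewrite (has_treeP (q := eq_op)); last exact: eq_treeP.
by rewrite -has_pred1; apply: eq_has => y /=; exact: eq_sym.
Qed.

Lemma diff_treeP A l :
  diff_tree (enc_listing A) (enc_seq enc_name l) = enc_seq enc_name (diff A l).
Proof.
rewrite /diff_tree (filter_treeP (q := fun A x => ~~ covered A x)) // => B x.
rewrite /uncovered_tree is_node_not; congr (~~ _).
exact: (has_treeP (q := fun (x : name) (s : seq name) => x \in s) _ _ mem_treeP).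
Qed.

Lemma sub_treeP l y :
  is_node (sub_tree (enc_seq enc_name l) (enc_seq enc_name y)) = all (mem y) l.
Proof.
rewrite /sub_tree is_node_not (has_treeP (q := fun (y : seq name) x => x \notin y)).
  by rewrite -all_predC; apply: eq_all => x /=; rewrite negbK.
by move=> u x; rewrite /notmem_tree is_node_not mem_treeP.
Qed.

Lemma greedy_treeP k L : greedy_tree k (enc_listing L) = enc_listing (greedy k L).
Proof.
rewrite /greedy_tree /greedy tolist_enc -[Leaf in LHS]/(enc_listing [::]).
elim: L [::] => //= l L IH A.
by rewrite -IH /greedy_step diff_treeP is_node_drop; case: ifP.
Qed.

Lemma residual_treeP A L :
  residual_tree (enc_listing A) (enc_listing L) = enc_listing (residual A L).
Proof.
rewrite /residual_tree /residual tolist_enc -[Leaf in LHS]/(enc_listing [::]).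
elim: L [::] => //= l L IH M.
rewrite -IH /residual_step diff_treeP is_node_enc; congr foldl.
case: ifP => // _.
rewrite (has_treeP (q := fun (d y : seq name) => all (mem y) d)); last exact: sub_treeP.
case: ifP => //= _; congr Node.
rewrite (filter_treeP (q := fun (d y : seq name) => ~~ all (mem d) y)) // => u x.
by rewrite /notsub_tree is_node_not sub_treeP.
Qed.

Lemma cat_treeP A B :
  cat_tree (enc_listing A) (enc_listing B) = enc_listing (catrev A B).
Proof. by rewrite /cat_tree tolist_enc; elim: A B => //= x A IH B; rewrite -IH. Qed.

(** * Hereditary families *)

Lemma mem_diff A l x : (x \in diff A l) = (x \in l) && ~~ covered A x.
Proof. by rewrite mem_rev mem_filter andbC. Qed.

Lemma uniq_diff A l : uniq l -> uniq (diff A l).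
Proof. by move=> ul; rewrite rev_uniq filter_uniq. Qed.

Lemma greedy_rcons k L l :
  greedy k (rcons L l) = if k < size (diff (greedy k L) l)
    then diff (greedy k L) l :: greedy k L else greedy k L.
Proof. by rewrite /greedy -cats1 foldl_cat. Qed.

Lemma uniq_greedy k L : all uniq L -> all uniq (greedy k L).
Proof.
elim/last_ind: L => // L l IH; rewrite all_rcons greedy_rcons => /andP[ul /IH uL].
by case: ifP => //= _; rewrite uL uniq_diff.
Qed.

Lemma size_greedy k L g : g \in greedy k L -> k < size g.
Proof.
elim/last_ind: L => // L l IH; rewrite greedy_rcons; case: ifP => // kd.
by rewrite inE => /predU1P[->|].
Qed.

Lemma greedy_sub k L g : g \in greedy k L -> exists2 l, l \in L & {subset g <= l}.
Proof.
elim/last_ind: L => // L l IH; rewrite greedy_rcons => gG.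
have : g = diff (greedy k L) l \/ g \in greedy k L.
  by move: gG; case: ifP => _; [rewrite inE => /predU1P|right].
move=> [->|/IH[l' l'L gl']].
  by exists l; [rewrite mem_rcons mem_head | move=> x; rewrite mem_diff => /andP[]].
by exists l' => //; rewrite mem_rcons inE l'L orbT.
Qed.

(** Each new set is stripped of all elements of the earlier ones before it is added. *)
Lemma greedy_disjoint k L : pairwise (fun g h : seq name => ~~ has (mem h) g) (greedy k L).
Proof.
elim/last_ind: L => // L l IH; rewrite greedy_rcons; case: ifP => //= _.
rewrite IH andbT; apply/allP => h hG; apply/hasPn => x.
by rewrite mem_diff => /andP[_]; apply: contra => /= xh; apply/hasP; exists h.
Qed.

(** When its turn comes, [l] either has at most [k] uncovered elements or gets all of them covered;
    later selections can only shrink its remainder. *)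
Lemma size_diff_greedy k L l : l \in L -> size (diff (greedy k L) l) <= k.
Proof.
elim/last_ind: L => // L l' IH; rewrite mem_rcons inE greedy_rcons.
have mono A d l1 : size (diff (d :: A) l1) <= size (diff A l1).
  rewrite !size_rev !size_filter; apply: sub_count => x /=.
  by rewrite negb_or => /andP[].
move=> /predU1P[->|/IH lk].
  case: ifP => [_|/negbT]; last by rewrite -leqNgt.
  suff -> : diff (diff (greedy k L) l' :: greedy k L) l' = [::] by [].
  apply: size0nil; rewrite size_rev size_filter; apply/eqP.
  rewrite -leqn0 leqNgt -has_count; apply/hasPn => x xl /=.
  by rewrite mem_diff xl negb_or negb_and negbK orbC; case: (covered _ _).
by case: ifP => // _; exact: leq_trans (mono _ _ _) lk.
Qed.

(** * Maximal remainders of the listed sets *)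

Lemma residual_rcons A L l :
  residual A (rcons L l) =
    if 0 < size (diff A l) then
      if has (fun y : seq name => all (mem y) (diff A l)) (residual A L)
      then residual A L
      else diff A l :: rev [seq y <- residual A L | ~~ all (mem (diff A l)) y]
    else residual A L.
Proof. by rewrite /residual -cats1 foldl_cat. Qed.

Lemma mem_residual A L m : m \in residual A L ->
  0 < size m /\ exists2 l, l \in L & m = diff A l.
Proof.
elim/last_ind: L => // L l IH; rewrite residual_rcons => mM.
have : (m = diff A l /\ 0 < size (diff A l)) \/ m \in residual A L.
  move: mM; case: ifP => d0; last by right.
  case: ifP => _; first by right.
  by rewrite inE mem_rev mem_filter => /predU1P[->|/andP[_]]; [left|right].
move=> [[-> d0]|/IH[m0 [l' l'L mE]]].
  by split=> //; exists l => //; rewrite mem_rcons mem_head.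
by split=> //; exists l' => //; rewrite mem_rcons inE l'L orbT.
Qed.

(** A remainder is skipped or evicted only in favour of one that contains it, and inclusion is
    transitive. *)
Lemma residual_cover A L l : l \in L -> 0 < size (diff A l) ->
  exists2 m, m \in residual A L & {subset diff A l <= m}.
Proof.
elim/last_ind: L => // L l' IH; rewrite mem_rcons inE residual_rcons => ll d0.
have : {subset diff A l <= diff A l'} \/
    exists2 m, m \in residual A L & {subset diff A l <= m}.
  by case/predU1P: ll => [->|lL]; [left | right; exact: IH].
move=> [sub|[m mM sub]].
  have d0' : 0 < size (diff A l').
    case: (diff A l) d0 sub => // x s _ /(_ x (mem_head _ _)).
    by case: (diff A l').
  rewrite d0'; case: hasP => [[m mM /allP ms]|_]; last first.
    by exists (diff A l') => //; exact: mem_head.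
  by exists m => // x /sub /ms.
case: ifP => _; last by exists m.
case: ifP => _; first by exists m.
case: (boolP (all (mem (diff A l')) m)) => [/allP md|nmd].
  by exists (diff A l'); [exact: mem_head | move=> x /sub /md].
by exists m => //; rewrite inE mem_rev mem_filter nmd mM orbT.
Qed.

(** A remainder enters only if no kept one contains it, and it evicts those it contains. The
    conclusion [m = m'] is an equality of lists, so two orderings of one set cannot both occur
    either. *)
Lemma residual_antichain A L :
  uniq (residual A L) /\
  {in residual A L &, forall m m' : seq name, {subset m <= m'} -> m = m'}.
Proof.
elim/last_ind: L => // L l [IHu IH]; rewrite residual_rcons.
case: ifP => // _; case: hasP => // nsub; split.
  rewrite /= rev_uniq filter_uniq // andbT mem_rev mem_filter negb_and negbK.
  by apply/orP; left; apply/allP.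
have nd m : m \in residual A L -> ~ {subset diff A l <= m}.
  by move=> mM sub; apply: nsub; exists m => //; apply/allP.
move=> m m'; rewrite !inE !mem_rev !mem_filter.
move=> /predU1P[->|/andP[/allPn[x xm xd] mM]] /predU1P[->|/andP[_ mM']] //.
- by move/(nd _ mM').
- by move=> /(_ _ xm) xd'; rewrite /= xd' in xd.
- exact: IH.
Qed.

(** * Maximal sets and the residual instance *)

Lemma maximal_set_above (S : family) s : s \in S ->
  exists2 t, t \in maximal_sets S & (s `<=` t)%fset.
Proof.
(* Passing to a proper superset in [S] decreases the gap to the largest cardinality. *)
have [n] := ubnP (\max_(t <- S) #|` t| - #|` s|)%fset.
elim: n s => // n IH s sn sS.
case: (boolP (has (fun t : {fset name} => s `<` t)%fset S)) => [/hasP[t tS st]|nst].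
  have lts := fproper_ltn_card st.
  have : (#|` t| <= \max_(t <- S) #|` t|)%fset by exact: leq_bigmax_seq.
  move=> ltm; have [|u uM tu] := IH t _ tS; first by move: sn; rewrite !ltnS; lia.
  by exists u => //; apply: fsubset_trans tu; exact: fproper_sub.
by exists s => //; rewrite !inE sS.
Qed.

(** All of [S] lies below [M], and no member of [M] lies below another, so maximality in [S] means
    membership in [M]. *)
Lemma lists_maximal_sets (M : seq (seq name)) (S : family) :
  all uniq M -> uniq M ->
  {in M &, forall m m' : seq name, {subset m <= m'} -> m = m'} ->
  {in M, forall m, 0 < size m} ->
  (forall s : {fset name}, s \in S <->
    s != fset0 /\ exists2 m, m \in M & {subset s <= m}) ->
  lists M (maximal_sets S).
Proof.
move=> au uM anti M0 SP; split => //; apply: uniq_perm.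
- rewrite map_inj_in_uniq // => m m' mM mM' /fsetP mm'.
  by apply: anti => // x xm; have := mm' x; rewrite !inE /= xm => <-.
- exact: fset_uniq.
have MS m : m \in M -> [fset x in m]%fset \in S.
  move=> mM; apply/SP; split; last by exists m => // x; rewrite !inE.
  have := M0 _ mM; case: m mM => // x m _ _; apply/fset0Pn.
  by exists x; rewrite !inE eqxx.
move=> s; apply/mapP/idP => [[m mM ->]|].
  rewrite !inE /= MS //=; apply/hasPn => t /SP[_ [m' mM' tm']].
  rewrite fproperE negb_and negbK -implybE; apply/implyP => /fsubsetP mt.
  have mE : m = m' by apply: anti => // x xm; apply: tm'; apply: mt; rewrite !inE.
  rewrite -mE in tm'.
  by apply/fsubsetP => x /tm'; rewrite !inE.
rewrite !inE /= => /andP[/SP[s0 [m mM sm]] /hasPn nst]; exists m => //.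
have sfm : (s `<=` [fset x in m])%fset by apply/fsubsetP => x /sm; rewrite !inE.
have := nst _ (MS _ mM); rewrite fproperE sfm negbK => fms.
by apply/eqP; rewrite eqEfsubset sfm.
Qed.

(** For [G] the greedy selection, this is the instance handed to the given algorithm. *)
Definition uncovered_sets (G : seq (seq name)) (S : family) : family :=
  [fset s in S | ~~ has (covered G) (s : {fset name})]%fset.

Lemma in_uncovered_sets G (S : family) (s : {fset name}) :
  (s \in uncovered_sets G S) = (s \in S) && ~~ has (covered G) s.
Proof. by rewrite !inE. Qed.

Lemma lists_mem L F (s : {fset name}) : lists L F ->
  s \in F -> exists2 l, l \in L & s = [fset x in l]%fset.
Proof. by move=> [_ /perm_mem LF] sF; apply/mapP; rewrite LF. Qed.

Lemma mem_lists L F l : lists L F -> l \in L -> [fset x in l]%fset \in F.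
Proof. by move=> [_ /perm_mem LF] lL; rewrite -[_ \in F]LF map_f. Qed.

(** Heredity allows the residual instance to be described by the remainders alone. Both its
    cardinality bound and the correctness of its listing rest on this description. *)
Lemma uncovered_setsP G S L : hereditary S -> lists L (maximal_sets S) ->
  forall s : {fset name}, s \in uncovered_sets G S <->
    s != fset0 /\ exists2 l, l \in L & {subset s <= diff G l}.
Proof.
move=> [S0 Sh] LS s; rewrite in_uncovered_sets; split.
  move=> /andP[sS /hasPn sG]; split; first by apply: contraNneq S0 => <-.
  have [t tM st] := maximal_set_above sS.
  have [l lL tE] := lists_mem LS tM; exists l => // x xs.
  by rewrite mem_diff sG // andbT; have /fsubsetP/(_ x xs) := st; rewrite tE !inE.
move=> [s0 [l lL sl]]; apply/andP; split; last first.
  by apply/hasPn => x /sl; rewrite mem_diff => /andP[].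
have : [fset x in l]%fset \in S.
  by have := mem_lists LS lL; rewrite !inE => /andP[].
move=> /Sh; apply=> //; apply/fsubsetP => x /sl.
by rewrite mem_diff !inE => /andP[].
Qed.

Lemma hereditary_uncovered_sets G S : hereditary S -> hereditary (uncovered_sets G S).
Proof.
move=> [S0 Sh]; split; first by rewrite in_uncovered_sets negb_and S0.
move=> s t; rewrite !in_uncovered_sets => /andP[sS /hasPn sG] ts t0.
rewrite (Sh _ _ sS ts t0); apply/hasPn => x xt; apply: sG.
by have /fsubsetP := ts; apply.
Qed.

Lemma hereditary_k_residual k S L : hereditary S -> lists L (maximal_sets S) ->
  hereditary_k k (uncovered_sets (greedy k L) S).
Proof.
move=> hS LS; split; first exact: hereditary_uncovered_sets.
move=> s /(uncovered_setsP _ hS LS)[_ [l lL sl]].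
by apply: leq_trans (size_diff_greedy k lL); apply: uniq_leq_size => //; exact: fset_uniq.
Qed.

Lemma lists_residual G S L : hereditary S -> lists L (maximal_sets S) ->
  lists (residual G L) (maximal_sets (uncovered_sets G S)).
Proof.
move=> hS LS; have [uR anti] := residual_antichain G L.
have /allP uL := LS.1.
apply: lists_maximal_sets => //.
- by apply/allP => m /mem_residual[_ [l lL ->]]; apply: uniq_diff; exact: uL.
- by move=> m /mem_residual[].
move=> s; rewrite (uncovered_setsP G hS LS); split.
  move=> [s0 [l lL sl]]; split => //.
  have [|m mM dm] := @residual_cover G L l lL.
    by have /fset0Pn[x /sl] := s0; case: (diff G l).
  by exists m => // x /sl /dm.
move=> [s0 [m /mem_residual[_ [l lL ->]] sm]]; split => //; by exists l.
Qed.

(** * Comparing the optimum with the weight of the combined solution *)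

Lemma covered_flatten G x : covered G x = (x \in flatten G).
Proof. by apply/hasP/flattenP => [[s]|[s]]; exists s. Qed.

(* Deleting the covered elements from a feasible solution loses at most one
   unit of weight per element. *)
Lemma optimum_uncovered_sets G S : hereditary S ->
  optimum S <= \sum_(g <- G) size g + optimum (uncovered_sets G S).
Proof.
move=> [S0 Sh]; apply/bigmax_leqP_seq => X _ /andP[/fsubsetP XS /[dup] trX /trivIfsetP disX].
pose U := [fset x in flatten G]%fset.
have inU x : (x \in U) = covered G x by rewrite covered_flatten !inE.
(* Wholly covered sets are dropped. On the others, removing [U] is injective, because disjoint sets
   cannot have the same nonempty remainder. *)
pose Y := [fset s in X | (s `\` U != fset0)%fset]%fset.
have YX s : s \in Y -> s \in X by rewrite !inE => /andP[].
pose Z := [fset (s `\` U)%fset | s in Y]%fset.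
have Uinj : {in Y &, injective (fun s : {fset name} => s `\` U)%fset}.
  move=> s t sY tY /= st; apply/eqP/negPn/negP => /(disX _ _ (YX _ sY) (YX _ tY)).
  move: sY; rewrite !inE => /andP[_ /fset0Pn[x xs]] /fdisjointP/(_ x).
  have := xs; rewrite st => /fsetDP[xt _]; rewrite xt => H.
  by case/fsetDP: xs => /H.
have countU (s : {fset name}) : count (mem U) s + count (predC (mem U)) s = #|` s|%fset.
  exact: count_predC.
have cntD (s : {fset name}) : count (predC (mem U)) s = #|` s `\` U|%fset.
  rewrite -size_filter; apply: perm_size; apply: uniq_perm; rewrite ?filter_uniq ?fset_uniq //.
  by move=> x; rewrite mem_filter in_fsetD.
have wZ : weight X <= \sum_(g <- G) size g + weight Z.
  have -> : weight Z = \sum_(s <- X) (#|` s `\` U|%fset - 1).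
    rewrite /weight /Z big_imfset //= /Y.
    rewrite big_fset /= big_mkcond /=; apply: eq_bigr => s _.
    (* A wholly covered set contributes [0 - 1], which is 0 in truncated subtraction. *)
    by case: ifP => // /negbFE/eqP ->; rewrite cardfs0.
  have le1 : weight X <= \sum_(s <- X) (count (mem U) s + (#|` s `\` U|%fset - 1)).
    by apply: leq_sum => s _; rewrite -countU cntD; lia.
  apply: leq_trans le1 _; rewrite big_split /= leq_add2r.
  (* As the members of [X] are disjoint, each covered element is counted at most once, and it occurs
     in [flatten G]. *)
  have -> : \sum_(s <- X) count (mem U) s = \sum_(x <- fcover X) (x \in U).
    rewrite big_trivIfset //; apply: eq_bigr => s _.
    by rewrite -sum1_count big_mkcond; apply: eq_bigr => x _ /=; case: (x \in U).
  have -> : \sum_(x <- fcover X) (x \in U) = count (mem U) (fcover X).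
    by rewrite -sum1_count [RHS]big_mkcond; apply: eq_bigr => x _ /=; case: (x \in U).
  have -> : \sum_(g <- G) size g = size (flatten G).
    by rewrite size_flatten sumnE big_map.
  rewrite -size_filter; apply: uniq_leq_size; first by rewrite filter_uniq ?fset_uniq.
  by move=> x; rewrite mem_filter /= !inE => /andP[].
apply: leq_trans wZ _; rewrite leq_add2l.
have ZP z : z \in Z -> exists2 s, s \in X & z = (s `\` U)%fset /\ z != fset0.
  move=> /imfsetP[s /= sY ->]; exists s; first exact: YX.
  by split => //; move: sY; rewrite !inE => /andP[].
have ZS : (Z `<=` uncovered_sets G S)%fset.
  apply/fsubsetP => z /ZP[s sX [zE z0]]; rewrite in_uncovered_sets.
  apply/andP; split; last by apply/hasPn => x; rewrite zE -inU => /fsetDP[].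
  by apply: Sh (XS _ sX) _ z0; rewrite zE; exact: fsubsetDl.
apply: leq_bigmax_seq; first by rewrite fpowersetE.
apply/andP; split => //; apply/trivIfsetP => z z' /ZP[s sX [-> _]] /ZP[t tX [-> _]] st.
have /(disX _ _ sX tX)/fdisjointP dst : s != t by apply: contra_neq st => ->.
by apply/fdisjointP => x /fsetDP[xs xU]; apply/negP => /fsetDP[xt _]; have := dst x xs; rewrite xt.
Qed.

Lemma card_fset_seq (l : seq name) : uniq l -> #|` [fset x in l]|%fset = size l.
Proof.
move=> ul; apply: perm_size; apply: uniq_perm; rewrite ?fset_uniq //.
by move=> x; rewrite !inE.
Qed.

(** Selected sets are mutually disjoint, and members of [A] avoid all their elements. Since selected
    sets are also nonempty, no set is listed twice and the weights simply add up. *)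
Lemma union_feasible k S L LA A :
  hereditary S -> lists L (maximal_sets S) ->
  lists LA A -> feasible (uncovered_sets (greedy k L) S) A ->
  exists B, [/\ lists (catrev (greedy k L) LA) B, feasible S B &
    weight B = \sum_(g <- greedy k L) (size g - 1) + weight A].
Proof.
move=> hS LS LAA /andP[/fsubsetP AS /trivIfsetP trA].
set G := greedy k L in AS *.
pose fs (l : seq name) := [fset x in l]%fset.
pose B : family := [fset s in map fs (catrev G LA)]%fset.
have uG : all uniq G by apply: uniq_greedy; exact: LS.1.
have memB s : s \in B -> (exists2 g, g \in G & s = fs g) \/ s \in A.
  rewrite !inE /= => /mapP[l]; rewrite catrevE mem_cat mem_rev => /orP[lG|lA] ->.
    by left; exists l.
  by right; apply: mem_lists lA.
have disG g h : g \in G -> h \in G -> g != h -> [disjoint fs g & fs h]%fset.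
  move=> gG hG gh; have /(pairwiseP [::]) pw := greedy_disjoint k L.
  rewrite -(nth_index [::] gG) -(nth_index [::] hG).
  have neq : index g G != index h G.
    by apply: contra_neq gh => e; rewrite -(nth_index [::] gG) e nth_index.
  move: neq; rewrite neq_ltn => /orP[lt|lt]; [|rewrite fdisjoint_sym];
    have := pw _ _ _ _ lt; rewrite !inE !index_mem gG hG => /(_ isT isT) /hasPn H;
    by apply/fdisjointP => x; rewrite !inE => /H.
have fsG0 g : g \in G -> fs g != fset0.
  move=> /size_greedy; case: (g) => // x l _; apply/fset0Pn.
  by exists x; rewrite !inE eqxx.
have disGA g s : g \in G -> s \in A -> [disjoint fs g & s]%fset.
  move=> gG /AS; rewrite in_uncovered_sets => /andP[_ /hasPn H].
  rewrite fdisjoint_sym; apply/fdisjointP => x /H; apply: contra; rewrite !inE => xg.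
  by apply/hasP; exists g.
have uB : uniq (map fs (catrev G LA)).
  rewrite catrevE map_cat cat_uniq; apply/and3P; split.
  - rewrite map_rev rev_uniq map_inj_in_uniq.
      (* A repeated entry of [G] would be nonempty and yet disjoint from itself. *)
      apply/(uniqPn [::]) => -[i [j [ij jG gij]]].
      have /(pairwiseP [::])/(_ i j) := greedy_disjoint k L.
      rewrite !inE -/G (ltn_trans ij jG) jG => /(_ isT isT ij); rewrite gij.
      have := size_greedy (mem_nth [::] jG); case: (nth _ _ _) => // x l _ /=.
      by rewrite mem_head.
    move=> g h gG hG gh; apply/eqP/negPn/negP => /(disG _ _ gG hG).
    rewrite gh => /fdisjointP d; have /fset0Pn[x xh] := fsG0 _ hG.
    by have := d _ xh; rewrite xh.
  - apply/hasPn => s /mapP[l lA ->] /=; rewrite map_rev mem_rev.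
    apply/mapP => -[g gG gl]; have := disGA _ _ gG (mem_lists LAA lA).
    rewrite -/(fs l) gl => /fdisjointP d; have /fset0Pn[x xh] := fsG0 _ gG.
    by have := d _ xh; rewrite xh.
  - by rewrite (perm_uniq LAA.2) fset_uniq.
have permB : perm_eq (map fs (catrev G LA)) (enum_fset B).
  apply: uniq_perm => //; first exact: fset_uniq.
  by move=> s; rewrite [in RHS]inE.
exists B; split.
- split => //; rewrite catrevE all_cat all_rev uG; exact: LAA.1.
- apply/andP; split.
    apply/fsubsetP => s /memB[[g gG ->]|/AS]; last by rewrite in_uncovered_sets => /andP[].
    have [l lL gl] := greedy_sub gG.
    have : fs l \in S by have := mem_lists LS lL; rewrite !inE => /andP[].
    move=> /(hS.2); apply; last exact: fsG0.
    by apply/fsubsetP => x; rewrite !inE => /gl.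
  apply/trivIfsetP => s t /memB[[g gG ->]|sA] /memB[[h hG ->]|tA] st.
  + by apply: disG => //; apply: contra_neq st => ->.
  + exact: disGA.
  + by rewrite fdisjoint_sym; exact: disGA.
  + exact: trA.
- rewrite /weight -(perm_big _ permB) /= catrevE map_cat big_cat /=.
  rewrite (perm_big _ LAA.2) /=; congr (_ + _).
  rewrite map_rev big_rev big_map /= big_seq [RHS]big_seq; apply: eq_bigr => g gG.
  by rewrite card_fset_seq //; have /allP := uG; apply.
Qed.

(** The selected sets lose at most the factor (k+1)/k and the residual part at most [alpha]; the
    maximum dominates both. *)
Lemma approx_ratio (R : realType) k (alpha : R) (G : seq (seq name)) (o o' w' : nat) :
  (1 <= k)%N -> (1 <= alpha)%R -> (forall g, g \in G -> k < size g) ->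
  o <= \sum_(g <- G) size g + o' -> (alpha^-1 * o'%:R <= w'%:R)%R ->
  ((Num.max alpha (k.+1%:R / k%:R))^-1 * o%:R <=
     (\sum_(g <- G) (size g - 1) + w')%:R)%R.
Proof.
move=> k1 a1 Gk oo ow; set m := Num.max _ _.
have am : (alpha <= m)%R by rewrite le_max lexx.
have km : (k.+1%:R / k%:R <= m)%R by rewrite le_max lexx orbT.
have a0 : (0 < alpha)%R by apply: lt_le_trans a1.
have m0 : (0 < m)%R by apply: lt_le_trans am.
have k0 : (0 < k%:R :> R)%R by rewrite ltr0n.
rewrite mulrC ler_pdivrMr //.
have {oo} oo : (o%:R <= (\sum_(g <- G) size g)%:R + o'%:R :> R)%R.
  by rewrite -natrD ler_nat.
apply: le_trans oo _; rewrite natrD mulrDl lerD //; last first.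
  move: ow; rewrite mulrC ler_pdivrMr // => /le_trans; apply.
  by rewrite ler_wpM2l // ler0n.
rewrite !natr_sum mulr_suml big_seq [leRHS]big_seq; apply: ler_sum => g /Gk gk.
apply: (@le_trans _ _ ((size g - 1)%:R * (k.+1%:R / k%:R))%R); last first.
  by rewrite ler_wpM2l // ler0n.
(* For [size g = j.+1] the claim is [j.+1 * k <= j * k.+1], that is, [k <= j]. *)
rewrite mulrA ler_pdivlMr // -!natrM ler_nat; case: (size g) gk => [|j] gk; rewrite ?subn1; [lia | rewrite /=; nia].
Qed.

(** * Determinism and the function computed by an approximation algorithm *)

Lemma exec_store_unique c m t m' : exec c m t m' ->
  forall t2 m2, exec c m t2 m2 -> m' = m2.
Proof.
elim => {c m t m'}.
- by move=> m t2 m2 ex; inversion ex.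
- by move=> x e m t2 m2 ex; inversion ex.
- move=> c1 c2 m t1 m1 t2 m2 _ IH1 _ IH2 t m' ex; inversion ex; subst.
  match goal with E1 : exec c1 _ _ _, E2 : exec c2 _ _ _ |- _ =>
    by move: E2; rewrite -(IH1 _ _ E1); exact: IH2 end.
- move=> e c1 c2 m t m' ev _ IH t2 m2 ex; inversion ex; subst.
    by match goal with E : exec c1 _ _ _ |- _ => exact: IH E end.
  by match goal with E : is_true (~~ _) |- _ => rewrite ev in E end.
- move=> e c1 c2 m t m' /negbTE ev _ IH t2 m2 ex; inversion ex; subst.
    by match goal with E : is_true (is_node _) |- _ => rewrite ev in E end.
  by match goal with E : exec c2 _ _ _ |- _ => exact: IH E end.
- move=> e c m t1 m1 t2 m2 ev _ IH1 _ IH2 t m' ex; inversion ex; subst.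
    match goal with E1 : exec c _ _ _, E2 : exec (While e c) _ _ m' |- _ =>
      by move: E2; rewrite -(IH1 _ _ E1); exact: IH2 end.
  by match goal with E : is_true (~~ _) |- _ => rewrite ev in E end.
- move=> e c m /negbTE ev t2 m2 ex; inversion ex; subst => //.
  by match goal with E : is_true (is_node _) |- _ => rewrite ev in E end.
Qed.

Lemma runs_output_unique c x t y t' y' : runs c x t y -> runs c x t' y' -> y = y'.
Proof. by move=> [m ex <-] [m' ex' <-]; rewrite (exec_store_unique ex ex'). Qed.

(** The closure properties concern functions, so one is extracted by choice, with value [Leaf] off
    the instance encodings. The choice only records the run and its time; determinism identifies the
    chosen output with the one that carries the guarantee. *)
Lemma approx_algorithm_function (R : realType) I (alpha : R) c :
  poly_approx_algorithm I alpha c ->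
  exists2 f, ptime_on (fun x => exists S L,
      [/\ I S, lists L (maximal_sets S) & x = enc_listing L]) f &
    forall S L, I S -> lists L (maximal_sets S) ->
      exists LA A, [/\ f (enc_listing L) = enc_listing LA, lists LA A,
        feasible S A & (alpha^-1 * (optimum S)%:R <= (weight A)%:R)%R].
Proof.
move=> [b [d H]].
pose D x := exists S L, [/\ I S, lists L (maximal_sets S) & x = enc_listing L].
have /choice[f fP] x : exists y, D x ->
    exists2 t, runs c x t y & t <= b * tsize x ^ d + b.
  have [[S [L [IS LS ->]]]|nD] := pselect (D x).
    by have [t [LA [A [run tb _ _ _]]]] := H S L IS LS; exists (enc_listing LA); exists t.
  by exists Leaf.
exists f.
  exists c, (fun n => b * n ^ d + b); split; last exact: fP.
  exists (b + b), d => n; rewrite mulnDl leq_add ?leq_pmulr ?expn_gt0 // leq_mul2l.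
  by case: (d) => [|d']; rewrite ?orbT // leq_exp2r // leqnSn orbT.
move=> S L IS LS; have [t [LA [A [run _ LAA fA wA]]]] := H S L IS LS.
exists LA, A; split=> //.
have [|t' run' _] := fP (enc_listing L); first by exists S, L.
exact: runs_output_unique run' run.
Qed.

Theorem theorem3 (R : realType) (k : nat) (alpha : R) :
  (1 <= k)%N -> (1 <= alpha)%R ->
  (exists c : cmd, poly_approx_algorithm (hereditary_k k) alpha c) ->
  exists c : cmd,
    poly_approx_algorithm hereditary (Num.max alpha (k.+1%:R / k%:R)%R) c.
Proof.
move=> k1 a1 [c /approx_algorithm_function[f fptime fP]].
pose I x := exists S L, [/\ hereditary S, lists L (maximal_sets S) & x = enc_listing L].
pose res x := residual_tree (greedy_tree k x) x.
have res_ptime : ptime_on I res.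
  apply: ptime_app2 ptime_residual _ _; last exact: ptime_id.
  exact: ptime_sub (ptime_greedy k).
have resI S L : hereditary S -> lists L (maximal_sets S) ->
    res (enc_listing L) = enc_listing (residual (greedy k L) L) /\
    lists (residual (greedy k L) L) (maximal_sets (uncovered_sets (greedy k L) S)).
  move=> hS LS; split; last exact: lists_residual.
  by rewrite /res greedy_treeP residual_treeP.
(* The whole algorithm: the greedy selection joined with the answer to the residual listing. *)
have : ptime_on I (fun x => cat_tree (greedy_tree k x) (f (res x))).
  apply: ptime_app2 ptime_cat (ptime_sub _ (ptime_greedy k)) _ => //.
  apply: ptime_comp fptime res_ptime _ => _ [S [L [hS LS ->]]].
  have [resE LR] := resI _ _ hS LS.
  by exists (uncovered_sets (greedy k L) S), (residual (greedy k L) L); split=> //;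
    exact: hereditary_k_residual.
(* The factor [2 ^ d] replaces the base [n.+1] by [n]: trees have positive size, so
   [n.+1 <= 2 * n]. *)
move=> [c' [B [[b [d Bbd]] c'P]]]; exists c', (b * 2 ^ d), d => S L hS LS.
have [|t run tB] := c'P (enc_listing L); first by exists S, L.
have [resE LR] := resI _ _ hS LS.
have [LA [A [fE LAA fA wA]]] := fP _ _ (hereditary_k_residual k hS LS) LR.
have [T [LT fT wT]] := union_feasible hS LS LAA fA.
exists t, (catrev (greedy k L) LA), T; split => //.
- by move: run; rewrite resE fE greedy_treeP cat_treeP.
- apply: leq_trans tB (leq_trans (Bbd _) (leq_trans _ (leq_addr _ _))).
  rewrite -mulnA leq_mul2l -expnMn; apply/orP; right.
  have := tsize_gt0 (enc_listing L).
  by case: (d) => // d' L0; rewrite leq_exp2r //; lia.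
rewrite wT; apply: approx_ratio a1 _ (optimum_uncovered_sets _ hS) wA => //.
exact: size_greedy.
Qed.
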